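(* Let $k\geq 1$, let $(a_t)_{t\in T}$ be a family of elements of $\tilde{\mathcal{P}}_k$, and let $b\in\tilde{\mathcal{P}}_k$. If $(a_t)_{t\in T}$ has a supremum in $\tilde{\mathcal{P}}_k$, then the family $(b\wedge a_t)_{t\in T}$ has a supremum in $\tilde{\mathcal{P}}_k$, and $$b\wedge\bigvee_{t\in T}a_t=\bigvee_{t\in T}(b\wedge a_t).$$ Similarly, if $(a_t)_{t\in T}$ has an infimum in $\tilde{\mathcal{P}}_k$, then the family $(b\vee a_t)_{t\in T}$ has an infimum in $\tilde{\mathcal{P}}_k$, and $$b\vee\bigwedge_{t\in T}a_t=\bigwedge_{t\in T}(b\vee a_t).$$
   Context: A $k$-poset is an object $(P;\leq,c)$ where $(P;\leq)$ is a partially ordered set and $c\colon P\to\{0,1,\dots,k-1\}$ is a labeling function. A homomorphism of $k$-posets is a map that preserves order ($x\leq y$ implies $h(x)\leq h(y)$) and labels. $\mathcal{P}_k$ is the class of all finite $k$-posets (including the empty one), quasiordered by $(P,c)\leq(P',c')$ if and only if there is a homomorphism $(P,c)\to(P',c')$; $\equiv$ is the induced equivalence, and $\tilde{\mathcal{P}}_k=\mathcal{P}_k/{\equiv}$ carries the induced partial order. $\tilde{\mathcal{P}}_k$ is a lattice, with operations computed on representatives: $(P,c)\vee(P',c')$ is the disjoint union (labels and order taken componentwise, elements of different components incomparable), and $(P,c)\wedge(P',c')$ is the label-matching product, i.e. the set $\{(x,y)\in P\times P'\mid c(x)=c'(y)\}$ with the componentwise order and with $(x,y)$ labeled by $c(x)=c'(y)$.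 Suprema and infima of families are taken in the poset $\tilde{\mathcal{P}}_k$. *)

(* Defs.v *)
From HB Require Import structures.
From mathcomp Require Import all_boot all_order.
From mathcomp Require Import boolp.

Set Implicit Arguments.
Unset Strict Implicit.
Unset Printing Implicit Defensive.

Import Order.Theory.
Local Open Scope order_scope.

Fact kposet_display : Order.disp_t. Proof. exact: Order.Disp tt tt. Qed.

(* [finPOrderType] allows the empty carrier. *)
Record kposet (k : nat) := KPoset {
  kp_sort :> finPOrderType kposet_display;
  kp_label : kp_sort -> 'I_k
}.

Definition kposet_hom k (P Q : kposet k) (h : P -> Q) : Prop :=
  {homo h : x y / x <= y} /\ forall x, kp_label (h x) = kp_label x.

Definition kposet_le k (P Q : kposet k) : Prop :=
  exists h : P -> Q, kposet_hom h.

Definition kposet_equiv k (P Q : kposet k) : Prop :=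
  kposet_le P Q /\ kposet_le Q P.

Section DisjointUnion.
Variables (k : nat) (P Q : kposet k).

Definition dunion : Type := (P + Q)%type.

HB.instance Definition _ := Finite.on dunion.

Definition dunion_le (u v : dunion) : bool :=
  match u, v with
  | inl x, inl y => x <= y
  | inr x, inr y => x <= y
  | _, _ => false
  end.

Fact dunion_le_refl : reflexive dunion_le.
Proof. by case=> x /=. Qed.

Fact dunion_le_anti : antisymmetric dunion_le.
Proof. by case=> x [] y //= /le_anti ->. Qed.

Fact dunion_le_trans : transitive dunion_le.
Proof. by case=> y [] x [] z //=; apply: le_trans. Qed.

HB.instance Definition _ := Order.Le_isPOrder.Build kposet_display dunion
  dunion_le_refl dunion_le_anti dunion_le_trans.

Definition dunion_label (u : dunion) : 'I_k :=
  match u with inl x => kp_label x | inr y => kp_label y end.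

Definition kposet_sum : kposet k := @KPoset k dunion dunion_label.

End DisjointUnion.

Section LabelMatchingProduct.
Variables (k : nat) (P Q : kposet k).

Definition label_match (u : P *prod[kposet_display] Q) : bool :=
  kp_label u.1 == kp_label u.2.

Definition lmprod : Type := {u : P *prod[kposet_display] Q | label_match u}.

HB.instance Definition _ := SubFinite.on lmprod.
HB.instance Definition _ :=
  [SubChoice_isSubPOrder of lmprod by <: with kposet_display].

Definition kposet_prod : kposet k :=
  @KPoset k lmprod (fun u => kp_label (\val u).1).

End LabelMatchingProduct.

Section Quasiorder.
Variable k : nat.
Implicit Types P Q R : kposet k.

Lemma kposet_le_refl P : kposet_le P P.
Proof. by exists id; split. Qed.

Lemma kposet_le_trans Q P R :
  kposet_le P Q -> kposet_le Q R -> kposet_le P R.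
Proof.
move=> [f [fle flab]] [g [gle glab]].
exists (g \o f); split=> [x y xy|x] /=; first exact/gle/fle.
by rewrite glab flab.
Qed.

Lemma kposet_equiv_refl P : kposet_equiv P P.
Proof. by split; apply: kposet_le_refl. Qed.

Lemma kposet_equiv_sym P Q : kposet_equiv P Q -> kposet_equiv Q P.
Proof. by case. Qed.

Lemma kposet_equiv_trans Q P R :
  kposet_equiv P Q -> kposet_equiv Q R -> kposet_equiv P R.
Proof.
move=> [PQ QP] [QR RQ]; split; first exact: kposet_le_trans PQ QR.
exact: kposet_le_trans RQ QP.
Qed.

Lemma kposet_sumP P Q R :
  kposet_le (kposet_sum P Q) R <-> kposet_le P R /\ kposet_le Q R.
Proof.
split=> [[h [hle hlab]]|[[f [fle flab]] [g [gle glab]]]].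
  split.
    exists (fun x => h (inl x)); split=> [x y xy|x]; first exact: hle.
    exact: hlab.
  exists (fun x => h (inr x)); split=> [x y xy|x]; first exact: hle.
  exact: hlab.
exists (fun u => match u with inl x => f x | inr y => g y end).
split; last by case.
by case=> x [] y //; [apply: fle|apply: gle].
Qed.

Lemma kposet_prodP P Q R :
  kposet_le R (kposet_prod P Q) <-> kposet_le R P /\ kposet_le R Q.
Proof.
split=> [[h [hle hlab]]|[[f [fle flab]] [g [gle glab]]]].
  split.
    exists (fun x => (\val (h x)).1); split=> [x y /hle/andP[]//|x].
    exact: hlab.
  exists (fun x => (\val (h x)).2); split=> [x y /hle/andP[]//|x].
  by rewrite -hlab; apply/esym/eqP/(valP (h x)).
have fg x : label_match (f x, g x) by rewrite /label_match /= flab glab.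
exists (fun x => exist _ (f x, g x) (fg x)); split=> [x y xy|x].
  by apply/andP; split; [apply: fle|apply: gle].
exact: flab.
Qed.

Lemma kposet_sum_le P P' Q Q' : kposet_le P P' -> kposet_le Q Q' ->
  kposet_le (kposet_sum P Q) (kposet_sum P' Q').
Proof.
have /kposet_sumP[inP inQ] := kposet_le_refl (kposet_sum P' Q').
move=> PP QQ; apply/kposet_sumP; split; first exact: kposet_le_trans PP inP.
exact: kposet_le_trans QQ inQ.
Qed.

Lemma kposet_prod_le P P' Q Q' : kposet_le P P' -> kposet_le Q Q' ->
  kposet_le (kposet_prod P Q) (kposet_prod P' Q').
Proof.
have /kposet_prodP[outP outQ] := kposet_le_refl (kposet_prod P Q).
move=> PP QQ; apply/kposet_prodP; split; first exact: kposet_le_trans outP PP.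
exact: kposet_le_trans outQ QQ.
Qed.

End Quasiorder.

(* The quotient is the type of equivalence classes, as predicates.  It is not
   equipped with the [porderType]/[latticeType] structures: [kposet k]
   quantifies over all [finPOrderType]s, so it lies in a universe strictly
   above that of the carriers of [eqType]s. *)
Record kclass (k : nat) := KClass {
  kclass_mem :> kposet k -> Prop;
  kclass_memP : exists P, kclass_mem = kposet_equiv P
}.

Definition kclass_pi k (P : kposet k) : kclass k :=
  KClass (ex_intro _ P erefl).

Definition kclass_le k (a b : kclass k) : Prop :=
  exists P Q, [/\ a P, b Q & kposet_le P Q].

Section Classes.
Variable k : nat.
Implicit Types (P Q R : kposet k) (a b c : kclass k).

Lemma kclass_eq a b : kclass_mem a = kclass_mem b -> a = b.
Proof.
case: a => A hA; case: b => B hB /= AB; case: _ / AB hB => hB.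
by rewrite (Prop_irrelevance hA hB).
Qed.

Lemma kclass_piP P Q : kclass_pi P = kclass_pi Q <-> kposet_equiv P Q.
Proof.
split=> [/(congr1 (@kclass_mem k))/(congr1 (fun A => A Q)) /= ->|PQ].
  exact: kposet_equiv_refl.
apply: kclass_eq => /=; apply/funext => R; apply/propext; split.
  exact/kposet_equiv_trans/kposet_equiv_sym.
exact: kposet_equiv_trans.
Qed.

Lemma kclassW (Pr : kclass k -> Prop) :
  (forall P, Pr (kclass_pi P)) -> forall a, Pr a.
Proof.
move=> h a; have [P aP] := kclass_memP a.
by rewrite (@kclass_eq a (kclass_pi P)).
Qed.

Lemma kclass_le_pi P Q :
  kclass_le (kclass_pi P) (kclass_pi Q) <-> kposet_le P Q.
Proof.
split=> [[P' [Q' [[PP _] [_ QQ] PQ]]]|PQ].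
  exact: kposet_le_trans PP (kposet_le_trans PQ QQ).
by exists P, Q; split=> //; apply: kposet_equiv_refl.
Qed.

Lemma kclass_le_refl a : kclass_le a a.
Proof. by elim/kclassW: a => P; apply/kclass_le_pi/kposet_le_refl. Qed.

Lemma kclass_le_anti a b : kclass_le a b -> kclass_le b a -> a = b.
Proof.
elim/kclassW: a => P; elim/kclassW: b => Q /kclass_le_pi PQ /kclass_le_pi QP.
exact/kclass_piP.
Qed.

Lemma kclass_le_trans b a c : kclass_le a b -> kclass_le b c -> kclass_le a c.
Proof.
elim/kclassW: a => P; elim/kclassW: b => Q; elim/kclassW: c => R.
move=> /kclass_le_pi PQ /kclass_le_pi QR.
exact/kclass_le_pi/(kposet_le_trans PQ QR).
Qed.

Fact kclass_meet_subproof a b :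
  exists R, (fun S => exists P Q,
    [/\ a P, b Q & kposet_equiv (kposet_prod P Q) S]) = kposet_equiv R.
Proof.
elim/kclassW: a => P; elim/kclassW: b => Q; exists (kposet_prod P Q).
apply/funext => S; apply/propext; split=> [|PQS]; last first.
  by exists P, Q; split=> //; apply: kposet_equiv_refl.
move=> [P' [Q' [[P1 P2] [Q1 Q2]]]]; apply: kposet_equiv_trans.
by split; apply: kposet_prod_le.
Qed.

Fact kclass_join_subproof a b :
  exists R, (fun S => exists P Q,
    [/\ a P, b Q & kposet_equiv (kposet_sum P Q) S]) = kposet_equiv R.
Proof.
elim/kclassW: a => P; elim/kclassW: b => Q; exists (kposet_sum P Q).
apply/funext => S; apply/propext; split=> [|PQS]; last first.
  by exists P, Q; split=> //; apply: kposet_equiv_refl.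
move=> [P' [Q' [[P1 P2] [Q1 Q2]]]]; apply: kposet_equiv_trans.
by split; apply: kposet_sum_le.
Qed.

Definition kclass_meet a b : kclass k := KClass (kclass_meet_subproof a b).
Definition kclass_join a b : kclass k := KClass (kclass_join_subproof a b).

Lemma kclass_meet_pi P Q :
  kclass_meet (kclass_pi P) (kclass_pi Q) = kclass_pi (kposet_prod P Q).
Proof.
have [R mR] := kclass_memP (kclass_meet (kclass_pi P) (kclass_pi Q)).
rewrite (@kclass_eq _ (kclass_pi R) mR); apply/kclass_piP.
rewrite -mR; exists P, Q.
by split; apply: kposet_equiv_refl.
Qed.

Lemma kclass_join_pi P Q :
  kclass_join (kclass_pi P) (kclass_pi Q) = kclass_pi (kposet_sum P Q).
Proof.
have [R mR] := kclass_memP (kclass_join (kclass_pi P) (kclass_pi Q)).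
rewrite (@kclass_eq _ (kclass_pi R) mR); apply/kclass_piP.
rewrite -mR; exists P, Q.
by split; apply: kposet_equiv_refl.
Qed.

Lemma kclass_meetP a b c :
  kclass_le c (kclass_meet a b) <-> kclass_le c a /\ kclass_le c b.
Proof.
elim/kclassW: a => P; elim/kclassW: b => Q; elim/kclassW: c => R.
by rewrite kclass_meet_pi !kclass_le_pi kposet_prodP.
Qed.

Lemma kclass_joinP a b c :
  kclass_le (kclass_join a b) c <-> kclass_le a c /\ kclass_le b c.
Proof.
elim/kclassW: a => P; elim/kclassW: b => Q; elim/kclassW: c => R.
by rewrite kclass_join_pi !kclass_le_pi kposet_sumP.
Qed.

(* Families are indexed by an arbitrary, possibly empty type. *)
Definition is_supremum (T : Type) (a : T -> kclass k) (s : kclass k) : Prop :=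
  (forall t, kclass_le (a t) s) /\
  (forall u, (forall t, kclass_le (a t) u) -> kclass_le s u).

Definition is_infimum (T : Type) (a : T -> kclass k) (i : kclass k) : Prop :=
  (forall t, kclass_le i (a t)) /\
  (forall l, (forall t, kclass_le l (a t)) -> kclass_le l i).

Lemma is_supremum_unique (T : Type) (a : T -> kclass k) s s' :
  is_supremum a s -> is_supremum a s' -> s = s'.
Proof. by move=> [us ls] [us' ls']; apply: kclass_le_anti; auto. Qed.

Lemma is_infimum_unique (T : Type) (a : T -> kclass k) i i' :
  is_infimum a i -> is_infimum a i' -> i = i'.
Proof. by move=> [li ui] [li' ui']; apply: kclass_le_anti; auto. Qed.

End Classes.

(* Main.v *)
Require Import Defs.
From HB Require Import structures.
From mathcomp Require Import all_boot.
From mathcomp Require Import all_order.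
From mathcomp Require Import boolp.

(** Meets distribute over a supremum [s] because, below [s], there is a
    substitute for the exponential [U ^ B].  Its natural points over [p : S]
    are the maps from the elements of [B] labeled like [p] to [U], but the
    natural relation between them is not transitive.  It is antisymmetric once
    the point [p] is recorded, and the finite sets of points having a top
    element, ordered by inclusion, then form a finite poset through which every
    homomorphism from a poset into this relational structure factors.

    Joins distribute over an infimum because a homomorphism [L -> B + A_t]
    splits [L] into two unions of components, one going to [B] and the other to
    [A_t]; removing from [L] a largest union of components that maps to [B]
    leaves a poset below all the [A_t]. *)

Set Implicit Arguments.
Unset Strict Implicit.
Unset Printing Implicit Defensive.

Import Order.Theory.

Section ToppedSets.
Local Open Scope order_scope.
Variables (k : nat) (N : finType) (r : rel N) (lab : N -> 'I_k).
Hypothesis r_anti : antisymmetric r.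

Definition topped (e : N * {set N}) : bool :=
  (e.1 \in e.2) && [forall g in e.2, r g e.1].

(* The phantom argument lets the order instance below be inferred from the type. *)
Definition topped_set (_ : antisymmetric r) : Type := {e | topped e}.

Local Notation E := (topped_set r_anti).

HB.instance Definition _ := SubFinite.on E.

Definition topped_le (d e : E) : bool := (val d).2 \subset (val e).2.

(** The top of [d] belongs to the smaller set, hence to the larger one, all of whose members are
    related to the top of [e]. *)
Lemma topped_le_rel (d e : E) : topped_le d e -> r (val d).1 (val e).1.
Proof.
move=> /subsetP de; have /andP[dd _] := valP d.
have /andP[_ /forall_inP re] := valP e.
exact/re/de.
Qed.

Fact topped_le_refl : reflexive topped_le.
Proof. by move=> d; apply: subxx. Qed.

Fact topped_le_anti : antisymmetric topped_le.
Proof.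
move=> d e /andP[de ed]; apply: val_inj.
have E1 : (val d).1 = (val e).1 by apply: r_anti; rewrite !topped_le_rel.
have E2 : (val d).2 = (val e).2 by apply/eqP; rewrite eqEsubset; apply/andP.
by case: (val d) (val e) E1 E2 => [? ?] [? ?] /= -> ->.
Qed.

Fact topped_le_trans : transitive topped_le.
Proof. by move=> e d f; apply: subset_trans. Qed.

HB.instance Definition _ := Order.Le_isPOrder.Build kposet_display E
  topped_le_refl topped_le_anti topped_le_trans.

Definition topped_kposet : kposet k :=
  @KPoset k E (fun e => lab (val e).1).

(** Each [x] goes to the image under [h] of its principal down-set, with top [h x]; transitivity in
    [X] makes these sets grow with [x]. *)
Lemma le_topped_kposet (X : kposet k) (h : X -> N) :
  (forall x y : X, x <= y -> r (h x) (h y)) ->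
  (forall x : X, lab (h x) = kp_label x) ->
  kposet_le X topped_kposet.
Proof.
move=> hr hlab.
have top x : topped (h x, [set h z | z in [pred z | z <= x]]).
  apply/andP; split; first by apply/imset_f; rewrite inE.
  by apply/forall_inP => g /imsetP[z]; rewrite inE => zx ->; apply: hr.
exists (fun x => exist topped _ (top x)); split=> [x y xy|x]; last exact: hlab.
apply/imsetS/subsetP => z; rewrite !inE => zx; exact: le_trans zx xy.
Qed.

End ToppedSets.

Section RelativeExponential.
Local Open Scope order_scope.
Variables (k : nat) (S B U : kposet k).

Let N : finType := (S * {ffun B -> option U})%type.

(* Forcing [None] off the fibre over [kp_label q.1] makes [exp_rel]
   antisymmetric. *)
Definition exp_point (q : N) : bool := [forall y : B,
  if q.2 y is Some v
  then (kp_label y == kp_label q.1) && (kp_label v == kp_label y)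
  else kp_label y != kp_label q.1].

(** Transitivity can fail: a comparison [y <= y'] in [B] need not pass through an element labeled
    like the intermediate point of [S]. A value [None] lies off the fibre and imposes no
    condition. *)
Definition exp_rel (q q' : N) : bool :=
  [&& exp_point q, exp_point q', q.1 <= q'.1 &
   [forall y : B, forall y' : B, (y <= y') ==>
     match q.2 y, q'.2 y' with Some v, Some v' => v <= v' | _, _ => true end]].

Lemma exp_rel_anti : antisymmetric exp_rel.
Proof.
move=> [p f] [p' f'] /andP[/and4P[/forallP/= nf /forallP/= nf' pp' /forallP ff']].
move=> /and4P[_ _ p'p /forallP/= f'f].
have Ep : p = p' by apply: le_anti; rewrite pp' p'p.
rewrite -{p' pp' p'p}Ep in nf' *; congr pair; apply/ffunP => y.
have := nf y; have := nf' y.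
have /forallP/(_ y) := ff' y; have /forallP/(_ y) := f'f y; rewrite lexx /=.
case: (f y) (f' y) => [v|] [v'|] //=.
- by move=> vv' v'v _ _; congr Some; apply: le_anti; rewrite vv' v'v.
- by move=> _ _ /negbTE->.
- by move=> _ _ /andP[->].
Qed.

Definition kposet_exp : kposet k :=
  topped_kposet (fun q : N => kp_label q.1) exp_rel_anti.

(** This is currying, with the base points supplied by the homomorphism from [X] to [S]. *)
Lemma le_kposet_exp (X : kposet k) :
  kposet_le X S -> kposet_le (kposet_prod B X) U -> kposet_le X kposet_exp.
Proof.
move=> [g [gle glab]] [h [hle hlab]].
(* [insub] fails exactly when the labels of [y] and [x] differ, which yields the [None] values that
   [exp_point] demands. *)
pose f (x : X) : {ffun B -> option U} :=
  [ffun y => omap h (insub (y, x) : option (kposet_prod B X))].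
have fP x : exp_point (g x, f x).
  apply/forallP => y /=; rewrite ffunE glab.
  case: insubP => [w wP wE|//] /=.
  have -> : kp_label (h w) = kp_label y.
    by rewrite hlab -[y]/(y, x).1 -wE.
  by rewrite eqxx andbT.
apply: (@le_topped_kposet _ _ _ _ _ _ (fun x => (g x, f x))) => [x y xy|x]; last first.
  exact: glab.
rewrite /exp_rel !fP gle //=; apply/forallP => z; apply/forallP => z'.
apply/implyP => zz'; rewrite !ffunE.
case: insubP => [w _ wE|//]; case: insubP => [w' _ w'E|//] /=.
by apply: hle; rewrite leEsub wE w'E; apply/andP.
Qed.

Lemma kposet_exp_eval : kposet_le (kposet_prod B kposet_exp) U.
Proof.
pose ev (w : kposet_prod B kposet_exp) : option U :=
  (val (val w).2).1.2 (val w).1.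
have evP w : exists v, ev w = Some v /\ kp_label v = kp_label w.
  (* The top belongs to its own set, so it is related to itself and satisfies [exp_point]; the
     matching labels then exclude [None]. *)
  have /andP[qS /forall_inP/(_ _ qS)/and4P[/forallP/(_ (val w).1) + _ _ _]] :=
    valP (val w).2.
  rewrite -/(ev w) [kp_label (val w).1 == _](valP w).
  by case: (ev w) => [v /eqP vw|//]; exists v.
have [h hP] := choice evP.
exists h; split=> [w w' /andP[w1 w2]|w]; last by case: (hP w).
have /and4P[_ _ _ /forallP/(_ (val w).1)/forallP/(_ (val w').1)] :=
  topped_le_rel w2.
by rewrite w1 -/(ev w) -/(ev w') (hP w).1 (hP w').1.
Qed.

End RelativeExponential.

Section Restriction.
Local Open Scope order_scope.
Variables (k : nat) (L : kposet k).
Implicit Types A B : {set L}.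

Definition restriction A : Type := {x | x \in A}.

HB.instance Definition _ A := SubFinite.on (restriction A).
HB.instance Definition _ A :=
  [SubChoice_isSubPOrder of restriction A by <: with kposet_display].

Definition kposet_restrict A : kposet k :=
  @KPoset k (restriction A) (fun x => kp_label (val x)).

Definition component_closed A : Prop :=
  forall x y : L, x <= y -> (x \in A) = (y \in A).

Lemma component_closedU A B :
  component_closed A -> component_closed B -> component_closed (A :|: B).
Proof. by move=> cA cB x y xy; rewrite !inE (cA _ _ xy) (cB _ _ xy). Qed.

(** No element of [A] is comparable to one outside [A], so sending [A] to the left and the rest to
    the right preserves order. *)
Lemma kposet_restrict_setU A B : component_closed A ->
  kposet_le (kposet_restrict (A :|: B))
            (kposet_sum (kposet_restrict A) (kposet_restrict B)).
Proof.
move=> cA.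
have inB (x : L) : x \in A :|: B -> x \notin A -> x \in B.
  by rewrite inE => /orP[->|].
pose h (x : kposet_restrict (A :|: B)) :
    kposet_sum (kposet_restrict A) (kposet_restrict B) :=
  match boolP (val x \in A) with
  | AltTrue xA => inl (exist _ (val x) xA)
  | AltFalse xA => inr (exist _ (val x) (inB _ (valP x) xA))
  end.
exists h; split=> [x y xy|x]; rewrite /h; last by case: {-}_ / boolP.
have Axy := cA _ _ xy.
case: {-}_ / boolP => xA; case: {-}_ / boolP => yA //; exfalso.
  by move: yA; rewrite -Axy xA.
by move: xA; rewrite Axy yA.
Qed.

Lemma kposet_restrict_setCP A (R : kposet k) : component_closed A ->
  kposet_le (kposet_restrict A) R -> kposet_le (kposet_restrict (~: A)) R ->
  kposet_le L R.
Proof.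
move=> cA AR CR.
have LT : kposet_le L (kposet_restrict (A :|: ~: A)).
  have inU (x : L) : x \in A :|: ~: A by rewrite setUCr inE.
  by exists (fun x => exist _ x (inU x)); split.
apply: kposet_le_trans LT _; apply: kposet_le_trans (kposet_restrict_setU _ cA) _.
exact/kposet_sumP.
Qed.

(** The two summands are mutually incomparable, so the preimage of [P] is a union of components. *)
Lemma kposet_le_sum_split (P Q : kposet k) : kposet_le L (kposet_sum P Q) ->
  exists A, [/\ component_closed A, kposet_le (kposet_restrict A) P &
                kposet_le (kposet_restrict (~: A)) Q].
Proof.
move=> [h [hle hlab]].
exists [set x | if h x is inl _ then true else false]; split.
- by move=> x y /hle; rewrite !inE; case: (h x) (h y) => [?|?] [?|?].
- have /choice[f fP] (x : kposet_restrict
      [set x | if h x is inl _ then true else false]) :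
      exists v, h (val x) = inl v.
    by have := valP x; rewrite inE; case: (h _) => // v; exists v.
  exists f; split=> [x y /hle|x]; first by rewrite !fP.
  by rewrite -[RHS]hlab fP.
- have /choice[f fP] (x : kposet_restrict
      (~: [set x | if h x is inl _ then true else false])) :
      exists v, h (val x) = inr v.
    by have := valP x; rewrite !inE; case: (h _) => // v; exists v.
  exists f; split=> [x y /hle|x]; first by rewrite !fP.
  by rewrite -[RHS]hlab fP.
Qed.

Lemma kposet_restrictS A B : A \subset B ->
  kposet_le (kposet_restrict A) (kposet_restrict B).
Proof.
move=> /subsetP AB.
by exists (fun x => exist _ (val x) (AB _ (valP x))); split.
Qed.

(** The sets with the first two properties are closed under union, so a maximal one contains all the
    others. *)
Lemma exists_max_restrict (R : kposet k) :
  exists A, [/\ component_closed A, kposet_le (kposet_restrict A) R &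
    forall B, component_closed B -> kposet_le (kposet_restrict B) R ->
      B \subset A].
Proof.
pose good A := `[< component_closed A /\ kposet_le (kposet_restrict A) R >].
have good0 : good set0.
  apply/asboolP; split=> [x y _|]; first by rewrite !inE.
  have no (x : kposet_restrict set0) : False by have := valP x; rewrite inE.
  by exists (fun x => False_rect _ (no x)); split=> x; case: (no x).
have [A /maxsetP[/asboolP[cA AR] maxA] _] := maxset_exists good0.
exists A; split=> // B cB BR.
rewrite -(maxA (A :|: B)) ?subsetUr ?subsetUl //; apply/asboolP.
split; first exact: component_closedU.
apply: kposet_le_trans (kposet_restrict_setU _ cA) _.
exact/kposet_sumP.
Qed.

End Restriction.

Theorem theorem4p5 (k : nat) (hk : 1 <= k) (T : Type) (a : T -> kclass k)
    (b : kclass k) :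
  (forall s : kclass k, is_supremum a s ->
     is_supremum (fun t => kclass_meet b (a t)) (kclass_meet b s)) /\
  (forall i : kclass k, is_infimum a i ->
     is_infimum (fun t => kclass_join b (a t)) (kclass_join b i)).
Proof.
elim/kclassW: b => B; split.
  elim/kclassW=> S [ub lub]; split=> [t|].
    have /kclass_meetP[mB mA] := kclass_le_refl (kclass_meet (kclass_pi B) (a t)).
    by apply/kclass_meetP; split=> //; apply: kclass_le_trans (ub t).
  elim/kclassW=> U aU; rewrite kclass_meet_pi; apply/kclass_le_pi.
  (* It remains to map [S] to [kposet_exp S B U]; as [S] is a least upper bound, this reduces to
     mapping each [a t], where currying applies. *)
  apply: kposet_le_trans (kposet_exp_eval S B U).
  apply: kposet_prod_le; first exact: kposet_le_refl.
  apply/kclass_le_pi/lub => t; move: (ub t) (aU t).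
  elim/kclassW: (a t) => X; rewrite kclass_meet_pi.
  move=> /kclass_le_pi XS /kclass_le_pi XU.
  exact/kclass_le_pi/le_kposet_exp.
elim/kclassW=> I [lb glb]; split=> [t|].
  have /kclass_joinP[jB jA] := kclass_le_refl (kclass_join (kclass_pi B) (a t)).
  by apply/kclass_joinP; split=> //; apply: kclass_le_trans jA.
elim/kclassW=> L La; rewrite kclass_join_pi; apply/kclass_le_pi.
have [A [cA AB maxA]] := exists_max_restrict L B.
have /kposet_sumP[inB inI] := kposet_le_refl (kposet_sum B I).
apply: (kposet_restrict_setCP cA); first exact: kposet_le_trans AB inB.
apply: kposet_le_trans inI; apply/kclass_le_pi/glb => t.
move: (La t); elim/kclassW: (a t) => X; rewrite kclass_join_pi.
move=> /kclass_le_pi/kposet_le_sum_split[C [cC CB CX]]; apply/kclass_le_pi.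
(* [C] maps to [B], so maximality puts it inside [A], and the complement of [A] inside that of
   [C]. *)
apply: kposet_le_trans CX; apply: kposet_restrictS.
by rewrite setCS; apply: maxA.
Qed.
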